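(* Every uniformly presented vector space is a finitely generated $\mathcal F$-representation, and conversely every finitely generated $\mathcal F$-representation is (isomorphic to) a uniformly presented vector space.
   Context: Conventions: maps act on the right, so for $f:X\to Y$, $g:Y\to Z$ the composite is written $fg:X\to Z$. $\mathcal F$ is the category with objects the finite sets $[k]=\{1,\dots,k\}$, $k\ge 0$, and all functions as morphisms. $\mathcal V$ is the category of finite-dimensional $\mathbb Q$-vector spaces. An $\mathcal F$-representation is a functor $V:\mathcal F\to\mathcal V$. $\mathbb Q\mathcal F$: objects are finite formal direct sums of objects of $\mathcal F$; $\mathbb Q\mathcal F([p],[q])$ is the free $\mathbb Q$-vector space on functions $[p]\to[q]$, with bilinear composition; morphisms between direct sums are matrices, composed by matrix multiplication. For an object $X$ of $\mathbb Q\mathcal F$, $\langle X\rangle=\mathbb Q\mathcal F(X,-)$, regarded as an $\mathcal F$-representation. For a morphism $f:X\to Y$ of $\mathbb Q\mathcal F$, $\langle f\rangle\subseteq\langle X\rangle$ is the image of the natural transformation $\mathbb Q\mathcal F(Y,-)\to\mathbb Q\mathcal F(X,-)$, $h\mapsto fh$. If $X\xrightarrow{f}Y\xrightarrow{g}Z$ are composable then $\langle fg\rangle\subseteq\langle f\rangle$. A uniformly presented vector space is an $\mathcal F$-representation given as a quotient $\langle f\rangle/\langle fg\rangle$ for some pair of composable morphisms $f,g$ of $\mathbb Q\mathcal F$. An $\mathcal F$-representation $V$ is finitely generated if there is an object $Y$ of $\mathbb Q\mathcal F$ and a surjection $\langle Y\rangle\to V$. *)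

(* Defs.v *)
From HB Require Import structures.
From mathcomp Require Import all_boot all_algebra.
Set Implicit Arguments.
Unset Strict Implicit.
Unset Printing Implicit Defensive.
Import GRing.Theory.
Local Open Scope ring_scope.
Local Open Scope quotient_scope.

Section QuotientSpace.
Variables (K : fieldType) (vT : vectType K) (W : {vspace vT}).

Definition vquot : Type := Quotient.quot (pred_of_vspace W : zmodClosed vT).

HB.instance Definition _ := Choice.on vquot.
HB.instance Definition _ := GRing.Zmodule.on vquot.

Definition vpi (x : vT) : vquot :=
  \pi_(Quotient.quot (pred_of_vspace W : zmodClosed vT)) x.

Definition vrepr (q : vquot) : vT :=
  repr (q : Quotient.quot (pred_of_vspace W : zmodClosed vT)).

Lemma vreprK q : vpi (vrepr q) = q.
Proof. exact: reprK. Qed.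

Lemma vpi_eq x y : (vpi x = vpi y) <-> (x - y \in W).
Proof.
split=> [/eqP|h]; first by rewrite -Quotient.idealrBE.
by apply/eqP; rewrite -Quotient.idealrBE.
Qed.

Lemma vpiD : {morph vpi : x y / x + y}.
Proof. by move=> x y; apply: (Quotient.pi_add (pred_of_vspace W)). Qed.

Definition vquot_scale (a : K) (q : vquot) : vquot := vpi (a *: vrepr q).

Lemma vpiZ a x : vpi (a *: x) = vquot_scale a (vpi x).
Proof. by apply/vpi_eq; rewrite -scalerBr memvZ //; apply/vpi_eq; rewrite vreprK. Qed.

Fact vquot_scaleA a b q :
  vquot_scale a (vquot_scale b q) = vquot_scale (a * b) q.
Proof. by rewrite -[q]vreprK -!vpiZ scalerA. Qed.

Fact vquot_scale1 : left_id 1 vquot_scale.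
Proof. by move=> q; rewrite -[q]vreprK -!vpiZ scale1r. Qed.

Fact vquot_scaleDr : right_distributive vquot_scale +%R.
Proof.
by move=> a q r; rewrite -[q]vreprK -[r]vreprK -vpiD -!vpiZ -vpiD scalerDr.
Qed.

Fact vquot_scaleDl q : {morph vquot_scale^~ q : a b / a + b}.
Proof. by move=> a b; rewrite -[q]vreprK -!vpiZ -vpiD scalerDl. Qed.

HB.instance Definition _ := GRing.Zmodule_isLmodule.Build K vquot
  vquot_scaleA vquot_scale1 vquot_scaleDr vquot_scaleDl.

Fact vpi_is_linear : linear vpi.
Proof. by move=> a x y; rewrite vpiD vpiZ. Qed.

HB.instance Definition _ := GRing.isSemilinear.Build K vT vquot _ vpi
  (GRing.semilinear_linear vpi_is_linear).

Fact vquot_vect_iso : Vector.axiom (\dim W^C) vquot.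
Proof.
pose C := (W^C)%VS.
have CW0 : (C :&: W = 0)%VS by rewrite capvC capv_compl.
have CWT : (C + W = fullv)%VS by rewrite addvC addv_complf.
pose c x := coord (vbasis C) ^~ (daddv_pi C W x).
have cW x y : vpi x = vpi y -> daddv_pi C W x = daddv_pi C W y.
  move=> /vpi_eq xyW; apply/eqP; rewrite -subr_eq0 -linearB /=.
  have xyC : x - y \in (C + W)%VS by rewrite CWT memvf.
  have := daddv_pi_add CW0 xyC; rewrite [X in _ + X]daddv_pi_id //; last first.
    by rewrite capvC.
  by move=> h; apply/eqP/(@addIr _ (x - y)); rewrite add0r.
have piC x : vpi (daddv_pi C W x) = vpi x.
  have xC : x \in (C + W)%VS by rewrite CWT memvf.
  apply/vpi_eq; rewrite -{2}(daddv_pi_add CW0 xC) opprD addrA subrr add0r.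
  by rewrite memvN memv_pi.
have rep x : daddv_pi C W (vrepr (vpi x)) = daddv_pi C W x.
  by apply: cW; rewrite vreprK.
exists (fun q => \row_i coord (vbasis C) i (daddv_pi C W (vrepr q))).
  move=> a q r; apply/rowP=> i; rewrite !mxE -[q]vreprK -[r]vreprK -linearP.
  by rewrite !rep !linearP.
exists (fun rw : 'rV_(\dim C) => vpi (\sum_i rw 0 i *: (vbasis C)`_i)).
  move=> q /=; rewrite -[RHS]vreprK -[RHS]piC; congr vpi.
  rewrite [RHS](coord_vbasis (memv_pi C W (vrepr q))).
  by apply: eq_bigr => i _; rewrite mxE.
move=> rw; apply/rowP=> i; rewrite mxE rep daddv_pi_id //.
  by rewrite coord_sum_free ?(basis_free (vbasisP C)).
by apply: rpred_sum => j _; rewrite rpredZ ?vbasis_mem ?memt_nth.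
Qed.

HB.instance Definition _ := Lmodule_hasFinDim.Build K vquot vquot_vect_iso.

End QuotientSpace.

(* Since maps act on the right, [fcomp], [qcomp] and [mcomp] apply their left *)
(* factor first; MathComp's [\o] on ['Hom] applies its right factor first.    *)
Definition fid (p : nat) : {ffun 'I_p -> 'I_p} := [ffun i => i].

Definition fcomp (p q r : nat) (a : {ffun 'I_p -> 'I_q})
    (b : {ffun 'I_q -> 'I_r}) : {ffun 'I_p -> 'I_r} := [ffun i => b (a i)].

Lemma fcompA p q r s (a : {ffun 'I_p -> 'I_q}) (b : {ffun 'I_q -> 'I_r})
    (c : {ffun 'I_r -> 'I_s}) : fcomp a (fcomp b c) = fcomp (fcomp a b) c.
Proof. by apply/ffunP=> i; rewrite !ffunE. Qed.

Lemma fcompf1 p q (a : {ffun 'I_p -> 'I_q}) : fcomp a (fid q) = a.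
Proof. by apply/ffunP=> i; rewrite !ffunE. Qed.

Lemma fcomp1f p q (a : {ffun 'I_p -> 'I_q}) : fcomp (fid p) a = a.
Proof. by apply/ffunP=> i; rewrite !ffunE. Qed.

Record Frep := MkFrep {
  fobj :> nat -> vectType rat;
  fmap : forall p q : nat, {ffun 'I_p -> 'I_q} -> 'Hom(fobj p, fobj q);
  fmap_id : forall p, fmap (fid p) = \1%VF;
  fmap_comp : forall p q r (a : {ffun 'I_p -> 'I_q}) (b : {ffun 'I_q -> 'I_r}),
    fmap (fcomp a b) = (fmap b \o fmap a)%VF }.

Record Ftrans (V W : Frep) := MkFtrans {
  component :> forall k : nat, 'Hom(V k, W k);
  naturality : forall p q (a : {ffun 'I_p -> 'I_q}),
    (component q \o fmap V a = fmap W a \o component p)%VF }.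

Definition Fsurjective (V W : Frep) (t : Ftrans V W) : Prop :=
  forall k, limg (t k) = fullv.

Definition Fiso (V W : Frep) : Prop :=
  exists (t : Ftrans V W) (s : Ftrans W V),
    forall k, (s k \o t k = \1)%VF /\ (t k \o s k = \1)%VF.

Record subFrep (V : Frep) := MkSubFrep {
  sub_at :> forall k : nat, {vspace V k};
  sub_stable : forall p q (a : {ffun 'I_p -> 'I_q}),
    (fmap V a @: sub_at p <= sub_at q)%VS }.

Section SubFrep.
Variables (V : Frep) (U : subFrep V).

Definition sub_map p q (a : {ffun 'I_p -> 'I_q}) :
    'Hom(subvs_of (U p), subvs_of (U q)) :=
  linfun (vsproj (U q) \o fmap V a \o vsval).

Lemma sub_mapE p q (a : {ffun 'I_p -> 'I_q}) (u : subvs_of (U p)) :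
  vsval (sub_map a u) = fmap V a (vsval u).
Proof.
rewrite lfunE /= vsprojK //; apply: (subvP (sub_stable U a)).
exact/memv_img/subvsP.
Qed.

Fact sub_map_id p : sub_map (fid p) = \1%VF.
Proof.
by apply/lfunP=> u; apply: val_inj; rewrite /= sub_mapE fmap_id !id_lfunE.
Qed.

Fact sub_map_comp p q r (a : {ffun 'I_p -> 'I_q}) (b : {ffun 'I_q -> 'I_r}) :
  sub_map (fcomp a b) = (sub_map b \o sub_map a)%VF.
Proof.
apply/lfunP=> u; apply: val_inj.
by rewrite /= comp_lfunE !sub_mapE fmap_comp comp_lfunE.
Qed.

Definition Fsub : Frep :=
  @MkFrep (fun k => subvs_of (U k)) sub_map sub_map_id sub_map_comp.

End SubFrep.

Section QuotFrep.
Variables (V : Frep) (W : subFrep V).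

Definition quot_map p q (a : {ffun 'I_p -> 'I_q}) :
    'Hom(vquot (W p), vquot (W q)) :=
  linfun (fun x : vquot (W p) => vpi (W q) (fmap V a (vrepr x))).

Lemma quot_mapE p q (a : {ffun 'I_p -> 'I_q}) (x : V p) :
  quot_map a (vpi (W p) x) = vpi (W q) (fmap V a x).
Proof.
have wd y z : vpi (W p) y = vpi (W p) z ->
    vpi (W q) (fmap V a y) = vpi (W q) (fmap V a z).
  move=> /vpi_eq yz; apply/vpi_eq; rewrite -linearB.
  exact: (subvP (sub_stable W a) _ (memv_img _ yz)).
pose h (x : vquot (W p)) := vpi (W q) (fmap V a (vrepr x)).
have hlin : linear h.
  move=> c y z; rewrite /h.
  transitivity (vpi (W q) (fmap V a (c *: vrepr y + vrepr z))).
    by apply: wd; rewrite [RHS]linearP /= !(@vreprK _ _ (W p)).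
  by rewrite [fmap V a _]linearP [LHS]linearP.
pose hM := GRing.isSemilinear.Build _ _ _ _ h (GRing.semilinear_linear hlin).
pose hL : {linear _ -> _} := HB.pack h hM.
rewrite /quot_map -/h -[h]/(hL : _ -> _) lfunE /=.
by apply: wd; rewrite (@vreprK _ _ (W p)).
Qed.

Fact quot_map_id p : quot_map (fid p) = \1%VF.
Proof.
by apply/lfunP=> x; rewrite -[x](@vreprK _ _ (W p)) quot_mapE fmap_id !id_lfunE.
Qed.

Fact quot_map_comp p q r (a : {ffun 'I_p -> 'I_q}) (b : {ffun 'I_q -> 'I_r}) :
  quot_map (fcomp a b) = (quot_map b \o quot_map a)%VF.
Proof.
apply/lfunP=> x.
by rewrite -[x](@vreprK _ _ (W p)) comp_lfunE !quot_mapE fmap_comp comp_lfunE.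
Qed.

Definition Fquot : Frep :=
  @MkFrep (fun k => vquot (W k)) quot_map quot_map_id quot_map_comp.

End QuotFrep.

Fact image_stable V W (t : Ftrans V W) p q (a : {ffun 'I_p -> 'I_q}) :
  (fmap W a @: limg (t p) <= limg (t q))%VS.
Proof. by rewrite -limg_comp -naturality limg_comp limgS ?subvf. Qed.

Definition Fimage V W (t : Ftrans V W) : subFrep W :=
  MkSubFrep (image_stable t).

Section SubQuotient.
Variables (V : Frep) (U W : subFrep V).

Definition restr_at k : {vspace Fsub U k} :=
  (linfun (vsval : subvs_of (U k) -> V k) @^-1: W k)%VS.

Fact restr_stable p q (a : {ffun 'I_p -> 'I_q}) :
  (fmap (Fsub U) a @: restr_at p <= restr_at q)%VS.
Proof.
apply/subvP=> _ /memv_imgP[u uW ->]; rewrite /restr_at -memv_preim lfunE /=.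
rewrite sub_mapE; apply: (subvP (sub_stable W a)); apply: memv_img.
by move: uW; rewrite /restr_at -memv_preim lfunE.
Qed.

Definition Frestr : subFrep (Fsub U) := MkSubFrep restr_stable.

(* Used only for W included in U, where it is U / W. *)
Definition Fsubquot : Frep := Fquot Frestr.

End SubQuotient.

(* The formal direct sum of the objects [summand i], for i < nsummands. *)
Record QFobj := MkQFobj {
  nsummands : nat;
  summand :> 'I_nsummands -> nat }.

Definition single (k : nat) : QFobj := @MkQFobj 1 (fun=> k).

Notation freeQ p q := {ffun {ffun 'I_p -> 'I_q} -> rat^o}.

Definition basisQ p q (a : {ffun 'I_p -> 'I_q}) : freeQ p q :=
  [ffun b => (b == a)%:R].

Definition qcomp p q r (u : freeQ p q) (v : freeQ q r) : freeQ p r :=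
  \sum_a \sum_b (u a * v b) *: basisQ (fcomp a b).

Lemma sum_basisQ p q (a : {ffun 'I_p -> 'I_q}) (T : lmodType rat)
    (F : {ffun 'I_p -> 'I_q} -> T) : \sum_b basisQ a b *: F b = F a.
Proof.
rewrite (bigD1 a) //= ffunE eqxx scale1r big1 ?addr0 // => b /negPf nba.
by rewrite ffunE nba scale0r.
Qed.

Lemma qcomp_basisl p q r (a : {ffun 'I_p -> 'I_q}) (v : freeQ q r) :
  qcomp (basisQ a) v = \sum_b v b *: basisQ (fcomp a b).
Proof.
rewrite -(sum_basisQ a (fun a => \sum_b v b *: basisQ (fcomp a b))).
apply: eq_bigr => a' _; rewrite scaler_sumr.
by apply: eq_bigr => b _; rewrite scalerA.
Qed.

Lemma qcomp_basisr p q r (u : freeQ p q) (b : {ffun 'I_q -> 'I_r}) :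
  qcomp u (basisQ b) = \sum_a u a *: basisQ (fcomp a b).
Proof.
apply: eq_bigr => a _.
rewrite -(sum_basisQ b (fun b => basisQ (fcomp a b))) scaler_sumr.
by apply: eq_bigr => b' _; rewrite scalerA.
Qed.

Lemma qcomp_basis p q r (a : {ffun 'I_p -> 'I_q}) (b : {ffun 'I_q -> 'I_r}) :
  qcomp (basisQ a) (basisQ b) = basisQ (fcomp a b).
Proof. by rewrite qcomp_basisl sum_basisQ. Qed.

Fact qcomp_linearl p q r (v : freeQ q r) :
  linear (fun u : freeQ p q => qcomp u v).
Proof.
move=> c u u'; rewrite /qcomp scaler_sumr -big_split; apply: eq_bigr => a _ /=.
rewrite scaler_sumr -big_split; apply: eq_bigr => b _ /=.
by rewrite scalerA -scalerDl !ffunE mulrDl mulrA.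
Qed.

Fact qcomp_linearr p q r (u : freeQ p q) :
  linear (fun v : freeQ q r => qcomp u v).
Proof.
move=> c v v'; rewrite /qcomp scaler_sumr -big_split; apply: eq_bigr => a _ /=.
rewrite scaler_sumr -big_split; apply: eq_bigr => b _ /=.
by rewrite scalerA -scalerDl !ffunE mulrDr mulrCA.
Qed.

Definition qcomp_l p q r (u : freeQ p q) (v : freeQ q r) := qcomp u v.
Definition qcomp_r p q r (v : freeQ q r) (u : freeQ p q) := qcomp u v.

HB.instance Definition _ p q r (u : freeQ p q) :=
  GRing.isSemilinear.Build rat (freeQ q r) (freeQ p r) _ (qcomp_l u)
    (GRing.semilinear_linear (qcomp_linearr u)).
HB.instance Definition _ p q r (v : freeQ q r) :=
  GRing.isSemilinear.Build rat (freeQ p q) (freeQ p r) _ (qcomp_r v)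
    (GRing.semilinear_linear (qcomp_linearl v)).

Lemma qcompA p q r s (u : freeQ p q) (v : freeQ q r) (w : freeQ r s) :
  qcomp u (qcomp v w) = qcomp (qcomp u v) w.
Proof.
transitivity (\sum_a \sum_b \sum_c (u a * v b * w c) *:
    basisQ (fcomp a (fcomp b c))).
  rewrite -[LHS]/(qcomp_l u _) [qcomp v w]/qcomp linear_sum /=.
  rewrite [RHS]exchange_big /=; apply: eq_bigr => b _.
  rewrite linear_sum [RHS]exchange_big; apply: eq_bigr => c _ /=.
  rewrite linearZ /= /qcomp_l qcomp_basisr scaler_sumr; apply: eq_bigr => a _.
  by rewrite scalerA mulrC mulrA.
rewrite -[RHS]/(qcomp_r w _) [qcomp u v]/qcomp linear_sum /=; apply: eq_bigr => a _.
rewrite linear_sum /=; apply: eq_bigr => b _.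
rewrite linearZ /= /qcomp_r qcomp_basisl scaler_sumr; apply: eq_bigr => c _.
by rewrite scalerA fcompA.
Qed.

Lemma qcompu1 p q (u : freeQ p q) : qcomp u (basisQ (fid q)) = u.
Proof.
rewrite qcomp_basisr; apply/ffunP=> a; rewrite sum_ffunE (bigD1 a) //= !ffunE.
rewrite fcompf1 eqxx [X in X + _]mulr1 big1 ?addr0 // => b /negPf nba.
by rewrite !ffunE fcompf1 eq_sym nba [LHS]mulr0.
Qed.

(* Matrices with (i, j) entry in freeQ (X i) (Y j), laid out as vectors       *)
(* indexed by all triples (i, j, a) with a : [X i] -> [Y j], so that they     *)
(* inherit the vector space structure of finite functions.                    *)
Notation QFhom X Y :=
  {ffun {i : 'I_(nsummands X) & {j : 'I_(nsummands Y) &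
    {ffun 'I_(summand i) -> 'I_(summand j)}}} -> rat^o}.

Section Matrices.
Variables X Y : QFobj.

Definition triple i j (a : {ffun 'I_(X i) -> 'I_(Y j)}) :
    {i : 'I_(nsummands X) & {j : 'I_(nsummands Y) & {ffun 'I_(X i) -> 'I_(Y j)}}}
  := existT _ i (existT _ j a).

Definition entry i j (M : QFhom X Y) : freeQ (X i) (Y j) :=
  [ffun a => M (triple a)].

Definition matQ (E : forall i j, freeQ (X i) (Y j)) : QFhom X Y :=
  [ffun t => E (tag t) (tag (tagged t)) (tagged (tagged t))].

Lemma entryK E i j : entry i j (matQ E) = E i j.
Proof. by apply/ffunP=> a; rewrite !ffunE. Qed.

Lemma matQP (M N : QFhom X Y) : (forall i j, entry i j M = entry i j N) -> M = N.
Proof.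
move=> eMN; apply/ffunP=> -[i [j a]].
by have /ffunP/(_ a) := eMN i j; rewrite !ffunE.
Qed.

Fact entry_is_linear i j : linear (entry i j).
Proof. by move=> c M N; apply/ffunP=> a; rewrite !ffunE. Qed.

HB.instance Definition _ i j :=
  GRing.isSemilinear.Build rat (QFhom X Y) (freeQ (X i) (Y j)) _ (entry i j)
    (GRing.semilinear_linear (entry_is_linear i j)).

End Matrices.

Definition mcomp X Y Z (M : QFhom X Y) (N : QFhom Y Z) : QFhom X Z :=
  matQ (fun i k => \sum_j qcomp (entry i j M) (entry j k N)).

Lemma mcompA X Y Z T (M : QFhom X Y) (N : QFhom Y Z) (P : QFhom Z T) :
  mcomp M (mcomp N P) = mcomp (mcomp M N) P.
Proof.
apply: matQP => i l; rewrite !entryK.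
transitivity (\sum_j \sum_k
    qcomp (entry i j M) (qcomp (entry j k N) (entry k l P))).
  apply: eq_bigr => j _.
  by rewrite entryK -[LHS]/(qcomp_l _ _) linear_sum.
rewrite exchange_big; apply: eq_bigr => k _ /=.
rewrite entryK -[RHS]/(qcomp_r _ _) linear_sum.
by apply: eq_bigr => j _; rewrite qcompA.
Qed.

Definition mcomp_l X Y Z (M : QFhom X Y) (N : QFhom Y Z) := mcomp M N.
Definition mcomp_r X Y Z (N : QFhom Y Z) (M : QFhom X Y) := mcomp M N.

Fact mcomp_l_is_linear X Y Z (M : QFhom X Y) : linear (@mcomp_l X Y Z M).
Proof.
move=> c N N'; apply: matQP => i k; rewrite [RHS]linearP /= /mcomp_l !entryK scaler_sumr.
rewrite -big_split; apply: eq_bigr => j _ /=.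
by rewrite linearP qcomp_linearr.
Qed.

Fact mcomp_r_is_linear X Y Z (N : QFhom Y Z) : linear (@mcomp_r X Y Z N).
Proof.
move=> c M M'; apply: matQP => i k; rewrite [RHS]linearP /= /mcomp_r !entryK scaler_sumr.
rewrite -big_split; apply: eq_bigr => j _ /=.
by rewrite linearP qcomp_linearl.
Qed.

HB.instance Definition _ X Y Z (M : QFhom X Y) :=
  GRing.isSemilinear.Build rat (QFhom Y Z) (QFhom X Z) _ (mcomp_l M)
    (GRing.semilinear_linear (@mcomp_l_is_linear X Y Z M)).
HB.instance Definition _ X Y Z (N : QFhom Y Z) :=
  GRing.isSemilinear.Build rat (QFhom X Y) (QFhom X Z) _ (mcomp_r N)
    (GRing.semilinear_linear (@mcomp_r_is_linear X Y Z N)).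

(* The embedding of the function category: a function as a 1 x 1 matrix. *)
Definition inF p q (a : {ffun 'I_p -> 'I_q}) : QFhom (single p) (single q) :=
  @matQ (single p) (single q) (fun _ _ => basisQ a).

Lemma inF_comp p q r (a : {ffun 'I_p -> 'I_q}) (b : {ffun 'I_q -> 'I_r}) :
  inF (fcomp a b) = mcomp (inF a) (inF b).
Proof.
by apply: matQP => i k; rewrite !entryK big_ord1 !entryK qcomp_basis.
Qed.

Lemma mcomp_inF_id X p (M : QFhom X (single p)) : mcomp M (inF (fid p)) = M.
Proof.
apply: matQP => i k; rewrite !entryK big_ord1 !entryK qcompu1.
by rewrite [ord0]ord1 [k]ord1.
Qed.

Section Representable.
Variable X : QFobj.

Definition rep_at (k : nat) : vectType rat := QFhom X (single k).

Definition rep_map p q (a : {ffun 'I_p -> 'I_q}) : 'Hom(rep_at p, rep_at q) :=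
  linfun (@mcomp_r X (single p) (single q) (inF a)).

Fact rep_map_id p : rep_map (fid p) = \1%VF.
Proof.
by apply/lfunP=> M; rewrite lfunE id_lfunE; apply: mcomp_inF_id.
Qed.

Fact rep_map_comp p q r (a : {ffun 'I_p -> 'I_q}) (b : {ffun 'I_q -> 'I_r}) :
  rep_map (fcomp a b) = (rep_map b \o rep_map a)%VF.
Proof.
apply/lfunP=> M; rewrite comp_lfunE !lfunE /= /mcomp_r inF_comp.
exact: (@mcompA X (single p) (single q) (single r)).
Qed.

Definition representable : Frep := MkFrep rep_map_id rep_map_comp.

End Representable.

Section Precomposition.
Variables (X Y : QFobj) (f : QFhom X Y).

Definition precomp_at k : 'Hom(representable Y k, representable X k) :=
  linfun (@mcomp_l X Y (single k) f).

Fact precomp_natural p q (a : {ffun 'I_p -> 'I_q}) :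
  (precomp_at q \o fmap (representable Y) a =
   fmap (representable X) a \o precomp_at p)%VF.
Proof.
apply/lfunP=> M; rewrite !comp_lfunE /= /precomp_at /rep_map !lfunE /=.
exact: (@mcompA X Y (single p) (single q)).
Qed.

Definition precomp : Ftrans (representable Y) (representable X) :=
  MkFtrans precomp_natural.

Definition principal : subFrep (representable X) := Fimage precomp.

End Precomposition.

Lemma principal_mcomp X Y Z (f : QFhom X Y) (g : QFhom Y Z) k :
  (principal (mcomp f g) k <= principal f k)%VS.
Proof.
apply/subvP=> _ /memv_imgP[h _ ->]; rewrite /= /precomp_at lfunE /=.
rewrite /mcomp_l -mcompA -[mcomp f _]/(mcomp_l f _).
by rewrite -[mcomp_l f _]lfunE memv_img ?memvf.
Qed.

Definition uniformly_presented (V : Frep) : Prop :=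
  exists (X Y Z : QFobj) (f : QFhom X Y) (g : QFhom Y Z),
    V = Fsubquot (principal f) (principal (mcomp f g)).

Definition finitely_generated (V : Frep) : Prop :=
  exists (Y : QFobj) (t : Ftrans (representable Y) V), Fsurjective t.

(* Main.v *)
From HB Require Import structures.
From mathcomp Require Import all_boot all_algebra.
Require Import Defs.
Set Implicit Arguments.
Unset Strict Implicit.
Unset Printing Implicit Defensive.
Import GRing.Theory.
Local Open Scope ring_scope.

(** One direction is formal: <f> is by definition the image of <Y>, and a
    quotient of a finitely generated representation is finitely generated.

    For the converse, let t : <X> -> V be surjective, with kernel K. It is enough
    to find g : X -> Z with <g> = K, since then V is isomorphic to <id>/<id g>.
    A morphism out of X is a row of columns, each an element of some <X>(k), and
    <g> is the subrepresentation generated by the columns of g (lemmas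
    [principal_col_mat_sub] and [mem_principal_col_mat]). So everything rests on
    the noetherian property: K is generated by finitely many elements
    ([subFrep_principal]). As each <X>(k) is finite-dimensional, it suffices to
    bound the degrees in which K needs generators.

    Such a bound comes from an element of the monoid algebra of self-maps of
    {0, ..., n} that acts as zero on <[d]>(n+1) for d < n. For S not containing 0, let e_S send every element of S to 0
    and fix the others. If d < n, a function a from [d] to {0, ..., n} misses
    some x <> 0, so adding x to S or removing it from S does not change a e_S;
    hence the sum of (-1)^|S| a e_S over all S vanishes
    ([alternating_collapse]). Thus, when every summand of X is smaller than n,
    each v in <X>(n+1) is a linear combination of the v e_S with S nonempty,
    and such an e_S factors through [n]. An element of K in degree n+1 is
    therefore generated by elements of K in degree n
    ([subFrep_determined_low]). *)

(** * The alternating sum of collapsing maps *)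

Definition collapse n (S : {set 'I_n.+1}) : {ffun 'I_n.+1 -> 'I_n.+1} :=
  [ffun y => if y \in S then ord0 else y].

Lemma collapse_set0 n : collapse (set0 : {set 'I_n.+1}) = fid n.+1.
Proof. by apply/ffunP=> y; rewrite !ffunE inE. Qed.

Lemma fcomp_collapse_setU1 d n (a : {ffun 'I_d -> 'I_n.+1}) x S :
  x \notin codom a -> fcomp a (collapse (x |: S)) = fcomp a (collapse S).
Proof.
move=> xa; apply/ffunP=> y; rewrite !ffunE !inE.
by case: eqP => // ayx; rewrite -ayx codom_f in xa.
Qed.

Lemma exists_missed_nonzero d n (a : {ffun 'I_d -> 'I_n.+1}) :
  (d < n)%N -> exists2 x, x != ord0 & x \notin codom a.
Proof.
move=> dn; have: ~~ ([set: 'I_n.+1] \subset ord0 |: [set y in codom a]).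
  apply/negP => /subset_leq_card; rewrite cardsT card_ord leqNgt => /negP[].
  rewrite cardsU1 cardsE; apply: leq_ltn_trans (_ : 1 + d < n.+1)%N => //.
  apply: leq_add; first by case: (_ \in _).
  by rewrite (leq_trans (leq_image_card _ _)) // card_ord.
by move=> /subsetPn[x _]; rewrite !inE negb_or => /andP[]; exists x.
Qed.

(** Since a misses some x <> 0, the terms of S and of x |: S cancel. *)
Lemma alternating_collapse d n (a : {ffun 'I_d -> 'I_n.+1}) : (d < n)%N ->
  \sum_(S : {set 'I_n.+1} | ord0 \notin S)
    (-1) ^+ #|S| *: basisQ (fcomp a (collapse S)) = 0.
Proof.
move=> /(exists_missed_nonzero a)[x x0 xa].
rewrite (bigID (fun S : {set _} => x \in S)) /=.
rewrite (reindex_onto (fun S => x |: S) (fun S => S :\ x)) /=; last first.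
  by move=> S /andP[_ xS]; rewrite setD1K.
rewrite (eq_bigl (fun S : {set _} => (ord0 \notin S) && (x \notin S))); last first.
  move=> S; rewrite !inE eqxx eq_sym (negPf x0) andbT /=; congr (_ && _).
  apply/eqP/idP => [<-|xS]; first by rewrite !inE eqxx.
  by rewrite setU1K.
rewrite -big_split big1 // => S /andP[_ xS] /=.
by rewrite cardsU1 xS fcomp_collapse_setU1 // exprS mulN1r scaleNr addNr.
Qed.

Lemma fcomp_factor p n (c : {ffun 'I_p -> 'I_n.+1}) x : (0 < n)%N ->
  x \notin codom c ->
  exists (b : {ffun 'I_p -> 'I_n}) (l : {ffun 'I_n -> 'I_n.+1}), c = fcomp b l.
Proof.
move=> n0 xc; exists [ffun y => odflt (Ordinal n0) (unlift x (c y))].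
exists [ffun z => lift x z]; apply/ffunP=> y; rewrite !ffunE.
case: unliftP => //= cyx; by rewrite -cyx codom_f in xc.
Qed.

(** This is what lowers the degree: the image of [collapse S] omits every point
    of S, because ord0 is not one of them. *)
Lemma collapse_factor n (S : {set 'I_n.+1}) : S != set0 -> ord0 \notin S ->
  exists (b : {ffun 'I_n.+1 -> 'I_n}) (l : {ffun 'I_n -> 'I_n.+1}),
    collapse S = fcomp b l.
Proof.
move=> /set0Pn[x xS] S0; have x0 : x != ord0 by apply: contraNneq S0 => <-.
apply: (@fcomp_factor _ _ _ x).
  rewrite lt0n; apply: contraNneq x0 => n0; apply/eqP/val_inj.
  by case: x {xS} => /=; rewrite n0; case.
apply/codomP => -[y]; rewrite ffunE; case: ifPn => [_ /eqP|yS xy].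
  by rewrite (negPf x0).
by rewrite -xy xS in yS.
Qed.

(** * Finite generation of subrepresentations *)

Section Representable.
Variable X : QFobj.

Lemma entry_rep_map p q (c : {ffun 'I_p -> 'I_q}) (M : representable X p) i :
  @entry X (single q) i ord0 (fmap (representable X) c M) =
  qcomp (@entry X (single p) i ord0 M) (basisQ c).
Proof. by rewrite /= /rep_map lfunE /= /mcomp_r entryK big_ord1 entryK. Qed.

Lemma alternating_rep_map n (M : representable X n.+1) :
  (forall i, X i < n)%N ->
  \sum_(S : {set 'I_n.+1} | ord0 \notin S)
    (-1) ^+ #|S| *: fmap (representable X) (collapse S) M = 0.
Proof.
move=> Xn; apply: matQP => i j; rewrite [j]ord1 !linear_sum [RHS]linear0 /=.
pose u := @entry X (single n.+1) i ord0 M.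
transitivity (\sum_(S : {set 'I_n.+1} | ord0 \notin S) \sum_a
   u a *: ((-1) ^+ #|S| *: basisQ (fcomp a (collapse S)))).
  apply: eq_bigr => S _; rewrite linearZ /= entry_rep_map qcomp_basisr scaler_sumr.
  by apply: eq_bigr => a _; rewrite !scalerA mulrC.
by rewrite exchange_big big1 // => a _; rewrite -scaler_sumr alternating_collapse ?scaler0.
Qed.

(** With L the subrepresentation generated by K in degrees up to N, this says
    that K needs no generator in a degree above N. In the alternating sum the term of the
    empty set is M itself, and every other term comes from K in degree n. *)
Lemma subFrep_determined_low (K L : subFrep (representable X)) N :
  (forall i, X i < N)%N -> (forall k, (k <= N)%N -> (K k <= L k)%VS) ->
  forall k, (K k <= L k)%VS.
Proof.
move=> XN low; elim=> [|n IHn]; first exact: low.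
have [/low//|Nn] := leqP n.+1 N; apply/subvP => M MK.
have Xn i : (X i < n)%N by apply: leq_trans (XN i) _.
have := alternating_rep_map M Xn.
rewrite (bigD1 set0) ?inE //= cards0 scale1r collapse_set0 rep_map_id id_lfunE.
move=> /eqP; rewrite addr_eq0 => /eqP ->; rewrite memvN.
apply: rpred_sum => S /andP[S0 Sn0]; apply: rpredZ.
have [b [l ->]] := collapse_factor Sn0 S0.
rewrite rep_map_comp comp_lfunE.
apply: (subvP (sub_stable L l)); apply: memv_img; apply: (subvP IHn).
by apply: (subvP (sub_stable K b)); apply: memv_img.
Qed.

Variables (s : seq {k : nat & representable X k}).
Let gen (j : 'I_(size s)) := tnth (in_tuple s) j.

(** The universal property of a formal direct sum: the elements of s, of degrees
    k_1, ..., k_m, are the columns of one morphism from X to the direct sum of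
    the [k_j]. *)
Definition col_obj : QFobj := @MkQFobj (size s) (fun j => tag (gen j)).

Definition col_mat : QFhom X col_obj :=
  @matQ X col_obj (fun i j => @entry X (single (tag (gen j))) i ord0 (tagged (gen j))).

(** The elements of <col_mat> are the linear combinations of images of the
    listed elements under functions; the coefficients are those of h. *)
Lemma mcomp_col_mat k (h : QFhom col_obj (single k)) :
  mcomp col_mat h = \sum_(j < size s) \sum_(b : {ffun 'I_(tag (gen j)) -> 'I_k})
    h (@triple col_obj (single k) j ord0 b) *:
    fmap (representable X) b (tagged (gen j)).
Proof.
apply: (@matQP X (single k)) => i l; rewrite [l]ord1 entryK linear_sum /=.
apply: eq_bigr => j _; rewrite linear_sum entryK /qcomp exchange_big.
apply: eq_bigr => b _; rewrite linearZ /= entry_rep_map qcomp_basisr scaler_sumr.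
by apply: eq_bigr => a _; rewrite scalerA mulrC !ffunE.
Qed.

Lemma principal_col_mat_sub (K : subFrep (representable X)) :
  (forall j, tagged (gen j) \in K (tag (gen j))) ->
  forall k, (principal col_mat k <= K k)%VS.
Proof.
move=> sK k; apply/subvP => _ /memv_imgP[h _ ->].
rewrite /= /precomp_at lfunE /= /mcomp_l mcomp_col_mat.
apply: rpred_sum => j _; apply: rpred_sum => b _; apply: rpredZ.
exact/(subvP (sub_stable K b))/memv_img.
Qed.

Lemma mem_principal_col_mat j :
  tagged (gen j) \in principal col_mat (tag (gen j)).
Proof.
set k := tag (gen j).
(* The row that is the identity at summand j and zero at the others. *)
pose e := @triple col_obj (single k) j ord0 (fid k).
pose h : QFhom col_obj (single k) := [ffun t => (t == e)%:R].
suff -> : tagged (gen j) = precomp_at col_mat k h by apply: memv_img; apply: memvf.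
rewrite /precomp_at lfunE /= /mcomp_l mcomp_col_mat.
rewrite (bigD1 j) //= (bigD1 (fid k)) //= ffunE eqxx scale1r rep_map_id id_lfunE.
rewrite !big1 ?addr0 //.
  move=> j' nj; rewrite big1 // => b _; rewrite ffunE.
  case: eqP => [/(congr1 tag) /= ej|_]; last exact: scale0r.
  by rewrite ej eqxx in nj.
move=> b /negPf nb; rewrite ffunE; case: eqP => [/eqP|_]; last exact: scale0r.
by rewrite /e /triple !eq_Tagged /= nb.
Qed.

End Representable.

(** The columns are bases of K(k) for all k up to the bound N. *)
Lemma subFrep_principal X (K : subFrep (representable X)) :
  exists Z (g : QFhom X Z), forall k, principal g k = K k.
Proof.
pose N := (\max_i X i).+1.
pose s := [seq Tagged (fun k => rep_at X k) u |
             k <- iota 0 N.+1, u <- vbasis (K k)].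
exists (col_obj s), (col_mat s).
have sP t : t \in s -> tagged t \in K (tag t).
  by case/allpairsPdep => k [u [_ uK ->]]; apply: vbasis_mem.
suff le k : (K k <= principal (col_mat s) k)%VS.
  move=> k; apply/eqP; rewrite eqEsubv le andbT.
  by apply: principal_col_mat_sub => j; apply/sP/mem_tnth.
move: k; apply: (@subFrep_determined_low _ _ _ N).
  by move=> i; rewrite ltnS; apply: (leq_bigmax i).
move=> k kN; rewrite -(span_basis (vbasisP (K k))); apply/span_subvP => u uK.
have us : Tagged (fun k => rep_at X k) u \in s.
  by apply/allpairsPdep; exists k, u; rewrite mem_iota.
have /tnthP[j ej] : Tagged (fun k => rep_at X k) u \in in_tuple s by [].
by have := mem_principal_col_mat j; rewrite -ej.
Qed.

(** * The identity matrix *)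

(** Coefficient 1 at the identity function of each diagonal entry, 0 elsewhere.
    Defining the coefficients one by one avoids transporting [fid (X i)] along an
    equality of row and column indices. *)
Definition idQF X : QFhom X X :=
  [ffun t => [exists i, t == triple (X := X) (Y := X) (fid (X i))]%:R].

Lemma mcomp_idQF X Y (M : QFhom X Y) : mcomp (idQF X) M = M.
Proof.
apply: matQP => i k; rewrite entryK (bigD1 i) //= big1 ?addr0.
  have -> : entry i i (idQF X) = basisQ (fid (X i)).
    apply/ffunP=> b; rewrite !ffunE; congr (_ %:R); apply: congr1.
    apply/existsP/eqP => [[i' /eqP e]|->]; last by exists i.
    have ei : i = i' by have := congr1 tag e.
    by move: e; rewrite -ei => /eqP; rewrite !eq_Tagged => /eqP.
  rewrite qcomp_basisl; apply/ffunP=> b; rewrite sum_ffunE (bigD1 b) //= !ffunE.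
  rewrite fcomp1f eqxx [_ *: 1]mulr1 big1 ?addr0 // => b' /negPf nb.
  by rewrite !ffunE fcomp1f eq_sym nb scaler0.
move=> j nj; suff -> : entry i j (idQF X) = 0 by rewrite -[LHS]/(qcomp_r _ _) linear0.
apply/ffunP=> b; rewrite !ffunE; case: existsP => // -[i' /eqP e].
have ei := congr1 tag e; have ej := congr1 (fun t => val (tag (tagged t))) e.
by case/eqP: nj; apply/val_inj/(etrans ej)/(congr1 val (esym ei)).
Qed.

Lemma principal_idQF X k : principal (idQF X) k = fullv.
Proof.
apply/vspaceP => M; rewrite memvf.
suff -> : M = precomp_at (idQF X) k M by apply/memv_img/memvf.
by rewrite /precomp_at lfunE /= /mcomp_l mcomp_idQF.
Qed.

(** * Natural transformations and quotients *)

Lemma bijective_Fiso (V W : Frep) (t : Ftrans V W) :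
  (forall k, lker (t k) == 0)%VS -> Fsurjective t -> Fiso W V.
Proof.
move=> t0 ts.
have tK k : ((t k)^-1 \o t k = \1)%VF by apply: lker0_compVf.
have Kt k : (t k \o (t k)^-1 = \1)%VF.
  by apply/lfunP => w; rewrite comp_lfunE id_lfunE limg_lfunVK // ts memvf.
have nat_inv p q (a : {ffun 'I_p -> 'I_q}) :
    ((t q)^-1 \o fmap W a = fmap V a \o (t p)^-1)%VF.
  rewrite -[LHS]comp_lfun1r -(Kt p) comp_lfunA -(comp_lfunA _ _ (t p)).
  by rewrite -naturality comp_lfunA tK comp_lfun1l.
by exists (MkFtrans nat_inv), t => k; split; [exact: Kt | exact: tK].
Qed.

Definition Fcomp (U V W : Frep) (s : Ftrans U V) (t : Ftrans V W) : Ftrans U W.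
Proof.
exists (fun k => t k \o s k)%VF => p q a.
by rewrite -comp_lfunA naturality comp_lfunA naturality comp_lfunA.
Defined.

Lemma Fsurjective_comp (U V W : Frep) (s : Ftrans U V) (t : Ftrans V W) :
  Fsurjective s -> Fsurjective t -> Fsurjective (Fcomp s t).
Proof. by move=> ss ts k; rewrite limg_comp ss ts. Qed.

Definition Fcorestr (V W : Frep) (t : Ftrans V W) : Ftrans V (Fsub (Fimage t)).
Proof.
exists (fun k => linfun (vsproj (Fimage t k) \o t k)) => p q a.
apply/lfunP => x; apply: val_inj.
rewrite !comp_lfunE [RHS](sub_mapE (U := Fimage t)) !lfunE /=.
rewrite !vsprojK ?memv_img ?memvf //.
by rewrite -!comp_lfunE naturality.
Defined.

Lemma Fcorestr_surjective (V W : Frep) (t : Ftrans V W) :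
  Fsurjective (Fcorestr t).
Proof.
move=> k; apply/vspaceP => u; rewrite memvf.
have /memv_imgP[x _ ux] := subvsP u.
suff -> : u = Fcorestr t k x by apply/memv_img/memvf.
by apply: val_inj; rewrite lfunE /= -ux vsprojK ?subvsP.
Qed.

Definition Fproj (V : Frep) (W : subFrep V) : Ftrans V (Fquot W).
Proof.
exists (fun k => linfun (vpi (W k))) => p q a.
by apply/lfunP => x; rewrite !comp_lfunE /= !lfunE quot_mapE.
Defined.

Lemma Fproj_surjective (V : Frep) (W : subFrep V) : Fsurjective (Fproj W).
Proof.
move=> k; apply/vspaceP => q; rewrite memvf.
rewrite -[q](@vreprK _ _ (W k)) -[vpi _ _]lfunE.
by apply/memv_img/memvf.
Qed.

Section FirstIsomorphism.
Variables (P V : Frep) (t : Ftrans P V) (U W : subFrep P).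
Hypothesis WE : forall k, W k = lker (t k).

(** The map induced by t on the subquotient; as W is the kernel of t, the choice of
    the representative [vrepr q] does not affect the value
    (lemma [subquot_atE]). *)
Definition subquot_at k (q : Fsubquot U W k) : V k := t k (vsval (vrepr q)).

Lemma subquot_atE k (u : Fsub U k) :
  subquot_at (vpi (Frestr U W k) u) = t k (vsval u).
Proof.
have /vpi_eq := @vreprK _ _ (Frestr U W k) (vpi _ u).
rewrite -memv_preim lfunE WE memv_ker (linearB (@vsval _ _ (U k))) linearB.
by rewrite subr_eq0 => /eqP.
Qed.

Fact subquot_at_is_linear k : linear (@subquot_at k).
Proof.
move=> c q r; rewrite -[q](@vreprK _ _ (Frestr U W k)).
rewrite -[r](@vreprK _ _ (Frestr U W k)) -linearP !subquot_atE.
by rewrite !linearP.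
Qed.

HB.instance Definition _ k :=
  GRing.isSemilinear.Build rat (Fsubquot U W k) (V k) _ (@subquot_at k)
    (GRing.semilinear_linear (@subquot_at_is_linear k)).

Definition Fsubquot_map : Ftrans (Fsubquot U W) V.
Proof.
exists (fun k => linfun (@subquot_at k)) => p q a.
apply/lfunP => x; rewrite -[x](@vreprK _ _ (Frestr U W p)) !comp_lfunE !lfunE.
rewrite (quot_mapE (Frestr U W)) [LHS]subquot_atE (sub_mapE (U := U)).
rewrite -comp_lfunE naturality comp_lfunE; congr (fmap V a _).
exact/esym/subquot_atE.
Defined.

Lemma Fiso_subquot :
  Fsurjective t -> (forall k, U k = fullv) -> Fiso V (Fsubquot U W).
Proof.
move=> ts UE; apply: (@bijective_Fiso _ _ Fsubquot_map) => k.
  apply/eqP/eqP; rewrite -subv0; apply/subvP => q.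
  rewrite memv_ker lfunE /= => tq; rewrite memv0 -[q](@vreprK _ _ (Frestr U W k)).
  apply/eqP; rewrite -(linear0 (vpi (Frestr U W k))); apply/vpi_eq.
  by rewrite subr0 -memv_preim lfunE WE memv_ker.
apply/vspaceP => v; rewrite memvf.
have /memv_imgP[x _ ->] : v \in limg (t k) by rewrite ts memvf.
have xU : x \in U k by rewrite UE memvf.
suff -> : t k x = Fsubquot_map k (vpi _ (vsproj (U k) x)) by apply/memv_img/memvf.
by rewrite lfunE /= subquot_atE vsprojK.
Qed.

End FirstIsomorphism.

Fact lker_stable (V W : Frep) (t : Ftrans V W) p q (a : {ffun 'I_p -> 'I_q}) :
  (fmap V a @: lker (t p) <= lker (t q))%VS.
Proof.
apply/subvP => _ /memv_imgP[x + ->]; rewrite !memv_ker => /eqP tx.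
by rewrite -comp_lfunE naturality comp_lfunE tx linear0.
Qed.

Definition Fker (V W : Frep) (t : Ftrans V W) : subFrep V :=
  MkSubFrep (lker_stable t).

(** * The two notions coincide *)

Lemma uniformly_presented_fg V : uniformly_presented V -> finitely_generated V.
Proof.
move=> [X [Y [Z [f [g ->]]]]]; exists Y.
exists (Fcomp (Fcorestr (precomp f)) (Fproj _)).
exact: Fsurjective_comp (@Fcorestr_surjective _ _ _) (@Fproj_surjective _ _).
Qed.

Theorem theorem5p2 :
  (forall V : Frep, uniformly_presented V -> finitely_generated V) /\
  (forall V : Frep, finitely_generated V ->
    exists W : Frep, uniformly_presented W /\ Fiso V W).
Proof.
split; first exact: uniformly_presented_fg.
move=> V [X [t ts]]; have [Z [g gE]] := subFrep_principal (Fker t).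
exists (Fsubquot (principal (idQF X)) (principal (mcomp (idQF X) g))); split.
  by exists X, X, Z, (idQF X), g.
apply: (Fiso_subquot (t := t)) => //; last exact: principal_idQF.
by move=> k; rewrite mcomp_idQF gE.
Qed.
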